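(* Let $(\mathcal{D},\prec_\perp,\succ_\perp,\prec_\vdash,\prec_\dashv,\succ_\vdash,\succ_\dashv)$ be a six-dendriform algebra. For all $x,y\in\mathcal{D}$ define $$x\perp y=x\prec_\perp y+x\succ_\perp y,\qquad x\vdash y=x\prec_\vdash y+x\succ_\vdash y,\qquad x\dashv y=x\prec_\dashv y+x\succ_\dashv y.$$ Then $(\mathcal{D},\perp,\vdash,\dashv)$ is a tri-associative algebra.
   Context: Throughout, $\mathbb{K}$ is a field of characteristic zero; all vector spaces and (multi)linear maps are over $\mathbb{K}$, and all binary operations are bilinear. A dendriform algebra is a vector space $D$ with binary operations $\prec,\succ:D\otimes D\to D$ such that for all $x,y,z\in D$: $(x\prec y)\prec z=x\prec(y\prec z+y\succ z)$, $(x\succ y)\prec z=x\succ(y\prec z)$, $x\succ(y\succ z)=(x\prec y+x\succ y)\succ z$. A quadri-dendriform algebra is a vector space $\mathcal{D}$ with four binary operations $\prec_\vdash,\prec_\dashv,\succ_\vdash,\succ_\dashv$ such that for all $x,y,z\in\mathcal{D}$: (1) $(x\prec_\vdash y)\prec_\vdash z=(x\prec_\dashv y)\prec_\vdash z=x\prec_\vdash(y\prec_\vdash z+y\succ_\vdash z)$; (2) $(x\succ_\vdash y)\prec_\vdash z=(x\succ_\dashv y)\prec_\vdash z=x\succ_\vdash(y\prec_\vdash z)$; (3) $x\succ_\vdash(y\succ_\vdash z)=(x\prec_\vdash y+x\succ_\vdash y)\succ_\vdash z=(x\prec_\dashv y+x\succ_\dashv y)\succ_\vdash z=(x\prec_\vdash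 y+x\succ_\dashv y)\succ_\vdash z=(x\prec_\dashv y+x\succ_\vdash y)\succ_\vdash z$; (4) $(x\prec_\vdash y)\prec_\dashv z=x\prec_\vdash(y\prec_\dashv z+y\succ_\dashv z)$; (5) $(x\succ_\vdash y)\prec_\dashv z=x\succ_\vdash(y\prec_\dashv z)$; (6) $x\succ_\vdash(y\succ_\dashv z)=(x\prec_\vdash y+x\succ_\vdash y)\succ_\dashv z$; (7) $(x\prec_\dashv y)\prec_\dashv z=x\prec_\dashv(y\prec_\vdash z+y\succ_\vdash z)=x\prec_\dashv(y\prec_\dashv z+y\succ_\dashv z)=x\prec_\dashv(y\prec_\vdash z+y\succ_\dashv z)=x\prec_\dashv(y\prec_\dashv z+y\succ_\vdash z)$; (8) $(x\succ_\dashv y)\prec_\dashv z=x\succ_\dashv(y\prec_\vdash z)=x\succ_\dashv(y\prec_\dashv z)$; (9) $x\succ_\dashv(y\succ_\vdash z)=x\succ_\dashv(y\succ_\dashv z)=(x\prec_\dashv y+x\succ_\dashv y)\succ_\dashv z$. A six-dendriform algebra is a vector space $\mathcal{D}$ with six binary operations such that $(\mathcal{D},\prec_\perp,\succ_\perp)$ is a dendriform algebra, $(\mathcal{D},\prec_\vdash,\prec_\dashv,\succ_\vdash,\succ_\dashv)$ is a quadri-dendriform algebra, and for all $x,y,z\in\mathcal{D}$: (A) $(x\prec_\vdash y)\prec_\perp z=x\prec_\vdash(y\prec_\perp z+y\succ_\perp z)$; $(x\succ_\vdash y)\prec_\perp z=x\succ_\vdash(y\prec_\perp z)$; $x\succ_\vdash(y\succ_\perp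 z)=(x\prec_\vdash y+x\succ_\vdash y)\succ_\perp z$; $(x\prec_\dashv y)\prec_\perp z=x\prec_\perp(y\prec_\vdash z+y\succ_\vdash z)$; $(x\succ_\dashv y)\prec_\perp z=x\succ_\perp(y\prec_\vdash z)$; $x\succ_\perp(y\succ_\vdash z)=(x\prec_\dashv y+x\succ_\dashv y)\succ_\perp z$; $(x\prec_\perp y)\prec_\dashv z=x\prec_\perp(y\prec_\dashv z+y\succ_\dashv z)$; $(x\succ_\perp y)\prec_\dashv z=x\succ_\perp(y\prec_\dashv z)$; $x\succ_\perp(y\succ_\dashv z)=(x\prec_\perp y+x\succ_\perp y)\succ_\dashv z$; (B) $(x\prec_\perp y)\prec_\vdash z=(x\prec_\vdash y)\prec_\vdash z=(x\prec_\dashv y)\prec_\vdash z$; $(x\succ_\perp y)\prec_\vdash z=(x\succ_\vdash y)\prec_\vdash z=(x\succ_\dashv y)\prec_\vdash z$; $(x\prec_\perp y)\succ_\vdash z=(x\prec_\vdash y)\succ_\vdash z=(x\prec_\dashv y)\succ_\vdash z$; $(x\succ_\perp y)\succ_\vdash z=(x\succ_\vdash y)\succ_\vdash z=(x\succ_\dashv y)\succ_\vdash z$; (C) $x\prec_\dashv(y\prec_\perp z)=x\prec_\dashv(y\prec_\vdash z)=x\prec_\dashv(y\prec_\dashv z)$; $x\succ_\dashv(y\prec_\perp z)=x\succ_\dashv(y\prec_\vdash z)=x\succ_\dashv(y\prec_\dashv z)$; $x\prec_\dashv(y\succ_\perp z)=x\prec_\dashv(y\succ_\vdash z)=x\prec_\dashv(y\succ_\dashv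 z)$; $x\succ_\dashv(y\succ_\perp z)=x\succ_\dashv(y\succ_\vdash z)=x\succ_\dashv(y\succ_\dashv z)$. A di-associative algebra is a vector space $A$ with binary operations $\vdash,\dashv$ such that for all $x,y,z\in A$: $(x\dashv y)\dashv z=x\dashv(y\vdash z)$, $(x\dashv y)\dashv z=x\dashv(y\dashv z)$, $(x\vdash y)\dashv z=x\vdash(y\dashv z)$, $(x\dashv y)\vdash z=x\vdash(y\vdash z)$, $(x\vdash y)\vdash z=x\vdash(y\vdash z)$. A tri-associative algebra is a vector space $A$ with binary operations $\vdash,\dashv,\perp$ such that $(A,\vdash,\dashv)$ is a di-associative algebra, $(A,\perp)$ is an associative algebra, and for all $x,y,z\in A$: $(x\dashv y)\dashv z=x\dashv(y\perp z)$, $(x\perp y)\dashv z=x\perp(y\dashv z)$, $(x\dashv y)\perp z=x\perp(y\vdash z)$, $(x\vdash y)\perp z=x\vdash(y\perp z)$, $(x\perp y)\vdash z=x\vdash(y\vdash z)$. *)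

(* Defs.v *)
From mathcomp Require Import all_boot all_algebra.

Set Implicit Arguments.
Unset Strict Implicit.
Unset Printing Implicit Defensive.

Import GRing.Theory.
Local Open Scope ring_scope.

(* [bilinear_for] from mathcomp's sesquilinear.v lives in Type; this is its
   Prop counterpart for a binary operation on a single K-module. *)
Definition is_bilinear (K : fieldType) (D : lmodType K) (op : D -> D -> D) : Prop :=
  (forall y : D, linear (fun x : D => op x y)) /\ (forall x : D, linear (op x)).

Section Algebras.

Variables (K : fieldType) (D : lmodType K).

Section Dendriform.

Variables lp rp : D -> D -> D.
Local Notation "x ≺ y" := (lp x y) (at level 40, no associativity).
Local Notation "x ≻ y" := (rp x y) (at level 40, no associativity).

Record is_dendriform : Prop := IsDendriform {
  dend_bilin_l : is_bilinear lp;
  dend_bilin_r : is_bilinear rp;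
  dend_ll : forall x y z, (x ≺ y) ≺ z = x ≺ (y ≺ z + y ≻ z);
  dend_rl : forall x y z, (x ≻ y) ≺ z = x ≻ (y ≺ z);
  dend_rr : forall x y z, x ≻ (y ≻ z) = (x ≺ y + x ≻ y) ≻ z
}.

End Dendriform.

Section QuadriDendriform.

Variables lv ld rv rd : D -> D -> D.
Local Notation "x ≺⊢ y" := (lv x y) (at level 40, no associativity).
Local Notation "x ≺⊣ y" := (ld x y) (at level 40, no associativity).
Local Notation "x ≻⊢ y" := (rv x y) (at level 40, no associativity).
Local Notation "x ≻⊣ y" := (rd x y) (at level 40, no associativity).

Record is_quadri_dendriform : Prop := IsQuadriDendriform {
  quadri_bilin_lv : is_bilinear lv;
  quadri_bilin_ld : is_bilinear ld;
  quadri_bilin_rv : is_bilinear rv;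
  quadri_bilin_rd : is_bilinear rd;
  quadri_1 : forall x y z,
    (x ≺⊢ y) ≺⊢ z = (x ≺⊣ y) ≺⊢ z
    /\ (x ≺⊣ y) ≺⊢ z = x ≺⊢ (y ≺⊢ z + y ≻⊢ z);
  quadri_2 : forall x y z,
    (x ≻⊢ y) ≺⊢ z = (x ≻⊣ y) ≺⊢ z
    /\ (x ≻⊣ y) ≺⊢ z = x ≻⊢ (y ≺⊢ z);
  quadri_3 : forall x y z,
    [/\ x ≻⊢ (y ≻⊢ z) = (x ≺⊢ y + x ≻⊢ y) ≻⊢ z,
        (x ≺⊢ y + x ≻⊢ y) ≻⊢ z = (x ≺⊣ y + x ≻⊣ y) ≻⊢ z,
        (x ≺⊣ y + x ≻⊣ y) ≻⊢ z = (x ≺⊢ y + x ≻⊣ y) ≻⊢ z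
      & (x ≺⊢ y + x ≻⊣ y) ≻⊢ z = (x ≺⊣ y + x ≻⊢ y) ≻⊢ z];
  quadri_4 : forall x y z, (x ≺⊢ y) ≺⊣ z = x ≺⊢ (y ≺⊣ z + y ≻⊣ z);
  quadri_5 : forall x y z, (x ≻⊢ y) ≺⊣ z = x ≻⊢ (y ≺⊣ z);
  quadri_6 : forall x y z, x ≻⊢ (y ≻⊣ z) = (x ≺⊢ y + x ≻⊢ y) ≻⊣ z;
  quadri_7 : forall x y z,
    [/\ (x ≺⊣ y) ≺⊣ z = x ≺⊣ (y ≺⊢ z + y ≻⊢ z),
        x ≺⊣ (y ≺⊢ z + y ≻⊢ z) = x ≺⊣ (y ≺⊣ z + y ≻⊣ z),
        x ≺⊣ (y ≺⊣ z + y ≻⊣ z) = x ≺⊣ (y ≺⊢ z + y ≻⊣ z)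
      & x ≺⊣ (y ≺⊢ z + y ≻⊣ z) = x ≺⊣ (y ≺⊣ z + y ≻⊢ z)];
  quadri_8 : forall x y z,
    (x ≻⊣ y) ≺⊣ z = x ≻⊣ (y ≺⊢ z)
    /\ x ≻⊣ (y ≺⊢ z) = x ≻⊣ (y ≺⊣ z);
  quadri_9 : forall x y z,
    x ≻⊣ (y ≻⊢ z) = x ≻⊣ (y ≻⊣ z)
    /\ x ≻⊣ (y ≻⊣ z) = (x ≺⊣ y + x ≻⊣ y) ≻⊣ z
}.

End QuadriDendriform.

Section SixDendriform.

Variables lp rp lv ld rv rd : D -> D -> D.
Local Notation "x ≺⊥ y" := (lp x y) (at level 40, no associativity).
Local Notation "x ≻⊥ y" := (rp x y) (at level 40, no associativity).
Local Notation "x ≺⊢ y" := (lv x y) (at level 40, no associativity).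
Local Notation "x ≺⊣ y" := (ld x y) (at level 40, no associativity).
Local Notation "x ≻⊢ y" := (rv x y) (at level 40, no associativity).
Local Notation "x ≻⊣ y" := (rd x y) (at level 40, no associativity).

Record is_six_dendriform : Prop := IsSixDendriform {
  six_dend : is_dendriform lp rp;
  six_quadri : is_quadri_dendriform lv ld rv rd;
  six_A1 : forall x y z, (x ≺⊢ y) ≺⊥ z = x ≺⊢ (y ≺⊥ z + y ≻⊥ z);
  six_A2 : forall x y z, (x ≻⊢ y) ≺⊥ z = x ≻⊢ (y ≺⊥ z);
  six_A3 : forall x y z, x ≻⊢ (y ≻⊥ z) = (x ≺⊢ y + x ≻⊢ y) ≻⊥ z;
  six_A4 : forall x y z, (x ≺⊣ y) ≺⊥ z = x ≺⊥ (y ≺⊢ z + y ≻⊢ z);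
  six_A5 : forall x y z, (x ≻⊣ y) ≺⊥ z = x ≻⊥ (y ≺⊢ z);
  six_A6 : forall x y z, x ≻⊥ (y ≻⊢ z) = (x ≺⊣ y + x ≻⊣ y) ≻⊥ z;
  six_A7 : forall x y z, (x ≺⊥ y) ≺⊣ z = x ≺⊥ (y ≺⊣ z + y ≻⊣ z);
  six_A8 : forall x y z, (x ≻⊥ y) ≺⊣ z = x ≻⊥ (y ≺⊣ z);
  six_A9 : forall x y z, x ≻⊥ (y ≻⊣ z) = (x ≺⊥ y + x ≻⊥ y) ≻⊣ z;
  six_B1 : forall x y z,
    (x ≺⊥ y) ≺⊢ z = (x ≺⊢ y) ≺⊢ z /\ (x ≺⊢ y) ≺⊢ z = (x ≺⊣ y) ≺⊢ z;
  six_B2 : forall x y z,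
    (x ≻⊥ y) ≺⊢ z = (x ≻⊢ y) ≺⊢ z /\ (x ≻⊢ y) ≺⊢ z = (x ≻⊣ y) ≺⊢ z;
  six_B3 : forall x y z,
    (x ≺⊥ y) ≻⊢ z = (x ≺⊢ y) ≻⊢ z /\ (x ≺⊢ y) ≻⊢ z = (x ≺⊣ y) ≻⊢ z;
  six_B4 : forall x y z,
    (x ≻⊥ y) ≻⊢ z = (x ≻⊢ y) ≻⊢ z /\ (x ≻⊢ y) ≻⊢ z = (x ≻⊣ y) ≻⊢ z;
  six_C1 : forall x y z,
    x ≺⊣ (y ≺⊥ z) = x ≺⊣ (y ≺⊢ z) /\ x ≺⊣ (y ≺⊢ z) = x ≺⊣ (y ≺⊣ z);
  six_C2 : forall x y z,
    x ≻⊣ (y ≺⊥ z) = x ≻⊣ (y ≺⊢ z) /\ x ≻⊣ (y ≺⊢ z) = x ≻⊣ (y ≺⊣ z);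
  six_C3 : forall x y z,
    x ≺⊣ (y ≻⊥ z) = x ≺⊣ (y ≻⊢ z) /\ x ≺⊣ (y ≻⊢ z) = x ≺⊣ (y ≻⊣ z);
  six_C4 : forall x y z,
    x ≻⊣ (y ≻⊥ z) = x ≻⊣ (y ≻⊢ z) /\ x ≻⊣ (y ≻⊢ z) = x ≻⊣ (y ≻⊣ z)
}.

End SixDendriform.

Record is_assoc_algebra (op : D -> D -> D) : Prop := IsAssocAlgebra {
  assoc_bilin : is_bilinear op;
  assoc_assoc : associative op
}.

Section DiTriAssociative.

Variables perp vd da : D -> D -> D.
Local Notation "x ⊥ y" := (perp x y) (at level 40, no associativity).
Local Notation "x ⊢ y" := (vd x y) (at level 40, no associativity).
Local Notation "x ⊣ y" := (da x y) (at level 40, no associativity).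

Record is_di_associative : Prop := IsDiAssociative {
  di_bilin_vd : is_bilinear vd;
  di_bilin_da : is_bilinear da;
  di_1 : forall x y z, (x ⊣ y) ⊣ z = x ⊣ (y ⊢ z);
  di_2 : forall x y z, (x ⊣ y) ⊣ z = x ⊣ (y ⊣ z);
  di_3 : forall x y z, (x ⊢ y) ⊣ z = x ⊢ (y ⊣ z);
  di_4 : forall x y z, (x ⊣ y) ⊢ z = x ⊢ (y ⊢ z);
  di_5 : forall x y z, (x ⊢ y) ⊢ z = x ⊢ (y ⊢ z)
}.

Record is_tri_associative : Prop := IsTriAssociative {
  tri_di : is_di_associative;
  tri_assoc : is_assoc_algebra perp;
  tri_1 : forall x y z, (x ⊣ y) ⊣ z = x ⊣ (y ⊥ z);
  tri_2 : forall x y z, (x ⊥ y) ⊣ z = x ⊥ (y ⊣ z);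
  tri_3 : forall x y z, (x ⊣ y) ⊥ z = x ⊥ (y ⊢ z);
  tri_4 : forall x y z, (x ⊢ y) ⊥ z = x ⊢ (y ⊥ z);
  tri_5 : forall x y z, (x ⊥ y) ⊢ z = x ⊢ (y ⊢ z)
}.

End DiTriAssociative.

End Algebras.

(* Main.v *)
Require Import Defs.
From mathcomp Require Import all_boot all_algebra.
Import GRing.Theory.
Local Open Scope ring_scope.

(** Write [a], [b], [c], [d] for products each split as a left part plus a
    right part, [op = l + r].  A mixed associativity law
    [(x a y) b z = x c (y d z)] is then the sum of three equations:

      - [(x la y) lb z = x lc (y d z)],
      - [(x ra y) lb z = x rc (y ld z)],
      - [(x a y) rb z  = x rc (y rd z)].

    The left-hand sides add up to [(x a y) b z] because [lb] is additive on the
    left, the right-hand sides to [x c (y d z)] because [rc] is additive on the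
    right.  This is [split_assoc].

    The axioms of a six-dendriform algebra contain such a triple for every law
    of a tri-associative algebra except [(x -| y) -| z = x -| (y perp z)] and
    [(x perp y) |- z = x |- (y |- z)].  In these two, [perp] is the inner
    product on the right of [-|], respectively on the left of [|-].  There the
    axioms [six_C1] to [six_C4], respectively [six_B1] to [six_B4], identify
    the left parts of all three products, and likewise the right parts.  So
    [perp] may be replaced by [|-], which gives two di-associative laws. *)

Section Splitting.

Set Implicit Arguments.

Variables (K : fieldType) (D : lmodType K).
Implicit Types (op l r : D -> D -> D).

Lemma bilinear_addl op : is_bilinear op -> left_distributive op +%R.
Proof. by case=> lin_l _ x y z; have := lin_l z 1 x y; rewrite /= !scale1r. Qed.

Lemma bilinear_addr op : is_bilinear op -> right_distributive op +%R.
Proof. by case=> _ lin_r x y z; have := lin_r x 1 y z; rewrite !scale1r. Qed.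

Lemma bilinear_sum l r :
  is_bilinear l -> is_bilinear r -> is_bilinear (fun x y => l x y + r x y).
Proof.
move=> [l_l l_r] [r_l r_r]; split=> [y a u v | x a u v] /=.
  by rewrite (l_l y a u v) (r_l y a u v) scalerDr addrACA.
by rewrite (l_r x a u v) (r_r x a u v) scalerDr addrACA.
Qed.

(** The common source of the associativity laws. Allowing four different
    products lets one statement cover plain associativity and all the mixed
    laws. *)
Lemma split_assoc {la ra lb rb lc rc ld rd : D -> D -> D} :
    left_distributive lb +%R -> right_distributive rc +%R ->
    (forall x y z, lb (la x y) z = lc x (ld y z + rd y z)) ->
    (forall x y z, lb (ra x y) z = rc x (ld y z)) ->
    (forall x y z, rc x (rd y z) = rb (la x y + ra x y) z) ->
  forall x y z,
    lb (la x y + ra x y) z + rb (la x y + ra x y) z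
      = lc x (ld y z + rd y z) + rc x (ld y z + rd y z).
Proof.
move=> lbD rcD on_x on_y on_z x y z.
by rewrite lbD rcD on_x on_y on_z addrA.
Qed.

End Splitting.

Section DiAssociativity.

Set Implicit Arguments.

Variables (K : fieldType) (D : lmodType K) (lv ld rv rd : D -> D -> D).

(** Each di-associative law is an instance of [split_assoc]; the chains of
    equalities [quadri_1] to [quadri_3] each serve the two laws ending in
    [|- z], and [quadri_7] to [quadri_9] the two laws whose right-hand side
    starts with [x -|]. *)
Lemma quadri_dendriform_di_associative :
  is_quadri_dendriform lv ld rv rd ->
  is_di_associative (fun x y => lv x y + rv x y) (fun x y => ld x y + rd x y).
Proof.
case=> bil_lv bil_ld bil_rv bil_rd q1 q2 q3 q4 q5 q6 q7 q8 q9.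
have lvD := bilinear_addl bil_lv; have ldD := bilinear_addl bil_ld.
have rvD := bilinear_addr bil_rv; have rdD := bilinear_addr bil_rd.
split; try exact: bilinear_sum; apply: split_assoc => // x y z.
- by case: (q7 x y z).
- by case: (q8 x y z).
- by case: (q9 x y z) => -> ->.
- by case: (q7 x y z) => -> ->.
- by case: (q8 x y z) => -> ->.
- by case: (q9 x y z).
- by case: (q1 x y z).
- by case: (q2 x y z).
- by case: (q3 x y z) => -> ->.
- by case: (q1 x y z) => -> ->.
- by case: (q2 x y z) => -> ->.
- by case: (q3 x y z).
Qed.

End DiAssociativity.

Theorem proposition3p9 (K : fieldType) (charK0 : [pchar K] =i pred0)
  (D : lmodType K)
  (prec_perp succ_perp prec_vdash prec_dashv succ_vdash succ_dashv : D -> D -> D)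
  (sixD : is_six_dendriform prec_perp succ_perp
            prec_vdash prec_dashv succ_vdash succ_dashv) :
  is_tri_associative
    (fun x y : D => prec_perp x y + succ_perp x y)
    (fun x y : D => prec_vdash x y + succ_vdash x y)
    (fun x y : D => prec_dashv x y + succ_dashv x y).
Proof.
case: sixD => dend quadri A1 A2 A3 A4 A5 A6 A7 A8 A9 B1 B2 B3 B4 C1 C2 C3 C4.
have di := quadri_dendriform_di_associative quadri.
case: dend => bil_lp bil_rp dll drl drr.
case: quadri => bil_lv bil_ld bil_rv bil_rd _ _ _ _ _ _ _ _ _.
have lpDl := bilinear_addl bil_lp; have rpDr := bilinear_addr bil_rp.
have lvDl := bilinear_addl bil_lv; have rvDl := bilinear_addl bil_rv.
have rvDr := bilinear_addr bil_rv; have ldDl := bilinear_addl bil_ld.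
have ldDr := bilinear_addr bil_ld; have rdDr := bilinear_addr bil_rd.
split=> //.
- split; first exact: bilinear_sum.
  by move=> x y z; exact/esym/(split_assoc lpDl rpDr dll drl drr).
- (* Part by part, [x -| (y perp z) = x -| (y |- z)]. *)
  move=> x y z; rewrite (di_1 di) !ldDr !rdDr.
  by rewrite (C1 x y z).1 (C2 x y z).1 (C3 x y z).1 (C4 x y z).1.
- exact: split_assoc.
- exact: split_assoc.
- exact: split_assoc.
- (* Part by part, [(x perp y) |- z = (x |- y) |- z]. *)
  move=> x y z; rewrite -(di_5 di) !lvDl !rvDl.
  by rewrite (B1 x y z).1 (B2 x y z).1 (B3 x y z).1 (B4 x y z).1.
Qed.
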